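(* Let $\Theta\subseteq\mathbb R^d$, suppose Assumptions 1 and 2 hold with constants $L,B>0$, and let $\mu$ be a distribution on $\mathcal Z$ with $z_{1:n}=(z_1,\dots,z_n)$ i.i.d. from $\mu$. Let $\varepsilon>0$, $T\in\{0,\dots,n\}$, let $\Phi_n$ be any set of maps $\mathcal Z^n\to\Theta$, and let $\Phi_{T,\varepsilon}$ be a finite set of maps $\mathcal Z^n\to\Theta$ each depending on at most $T$ samples, such that for every $x_{1:n}\in\mathcal Z^n$ and every $\psi\in\Phi_n$ there is $\phi\in\Phi_{T,\varepsilon}$ with $\|\psi(x_{1:n})-\phi(x_{1:n})\|\le\varepsilon$. Then with probability at least $1-\delta$, for all $\psi\in\Phi_n$, $$\left|\hat F(\psi(z_{1:n}))-F(\psi(z_{1:n}))\right|\le\frac{BT}{n}+B\sqrt{\frac{\log(2|\Phi_{T,\varepsilon}|/\delta)}{2n}}+2L\varepsilon.$$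
   Context: $F(\theta):=\mathbb E_{Z\sim\mu}[f(\theta;Z)]$, $\hat F(\theta):=\frac1n\sum_{i=1}^nf(\theta;z_i)$ for a loss $f:\Theta\times\mathcal Z\to\mathbb R$. Assumption 1 (constant $L$): there is $h_0:\Theta\to\mathbb R$ with $|f(\theta;z)-h_0(\theta)-(f(\theta';z)-h_0(\theta'))|\le L\|\theta-\theta'\|$ for all $\theta,\theta'\in\Theta$, $z$. Assumption 2 (constant $B$): $\sup_zf(\theta;z)-\inf_zf(\theta;z)\le B$ for all $\theta\in\Theta$. A map $\phi:\mathcal Z^n\to\Theta$ ''depends on at most $T$ samples'' if there is $\mathcal I\subseteq[n]$ with $|\mathcal I|\le T$ such that $\phi(x_1,\dots,x_n)=\phi(x_1',\dots,x_n')$ whenever $x_i=x_i'$ for all $i\in\mathcal I$.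
   Formalization: The maps in the finite set Φ_{T,ε} are assumed measurable (also f(θ;·), δ>0, n≥1); for non-measurable φ the event can be non-measurable with inner probability 0, so the claim is undefined. ''With probability at least 1-δ'' means on some measurable event of that probability. *)

(* Defs.v *)
From HB Require Import structures.
From mathcomp Require Import all_boot all_order all_algebra.
From mathcomp Require Import all_classical all_reals all_analysis.
Set Implicit Arguments. Unset Strict Implicit. Unset Printing Implicit Defensive.
Import Order.TTheory GRing.Theory Num.Theory.
Local Open Scope classical_set_scope.
Local Open Scope ring_scope.

Definition enorm (R : realType) (d : nat) (v : 'rV[R]_d) : R :=
  Num.sqrt (\sum_(j < d) v ord0 j ^+ 2).

Definition rectangles (n : nat) (dZ : measure_display) (Z : measurableType dZ)
  : set (set ('I_n -> Z)) :=
  [set S | exists A : 'I_n -> set Z,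
     (forall i, measurable (A i)) /\ S = [set x | forall i, A i (x i)]].

Definition prodZ (n : nat) (dZ : measure_display) (Z : measurableType dZ) :=
  g_sigma_algebraType (@rectangles n dZ Z).

Definition is_iid_law (R : realType) (n : nat) (dZ : measure_display)
  (Z : measurableType dZ) (mu : probability Z R)
  (P : probability (prodZ n Z) R) : Prop :=
  forall A : 'I_n -> set Z, (forall i, measurable (A i)) ->
    P [set x | forall i, A i (x i)] = (\prod_(i < n) mu (A i))%E.

Definition depends_on_at_most (n : nat) (Z A : Type) (T : nat)
  (phi : ('I_n -> Z) -> A) : Prop :=
  exists I : {set 'I_n}, (#|I| <= T)%N /\
    forall x x' : 'I_n -> Z, (forall i, i \in I -> x i = x' i) -> phi x = phi x'.

Definition popF (R : realType) (d : nat) (dZ : measure_display)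
  (Z : measurableType dZ) (mu : probability Z R) (f : 'rV[R]_d -> Z -> R)
  (theta : 'rV[R]_d) : R :=
  Rintegral mu setT (f theta).

Definition empF (R : realType) (d n : nat) (Z : Type) (f : 'rV[R]_d -> Z -> R)
  (x : 'I_n -> Z) (theta : 'rV[R]_d) : R :=
  n%:R^-1 * \sum_(i < n) f theta (x i).

(* Main.v *)
Require Import Defs.
From HB Require Import structures.
From mathcomp Require Import all_boot all_order all_algebra.
From mathcomp Require Import all_classical all_reals all_analysis.
From mathcomp Require Import measurable_realfun ring lra.
Import Order.TTheory GRing.Theory Num.Theory.
Import numFieldNormedType.Exports.
Local Open Scope classical_set_scope.
Local Open Scope ring_scope.
Set Implicit Arguments. Unset Strict Implicit. Unset Printing Implicit Defensive.

(* Fix phi in the finite class and let I be the set of at most T samples it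
   reads. After centering f by its mean, each sample of I moves the empirical
   mean by at most B / n; given the samples of I the parameter phi(z) is frozen
   and the other samples are still i.i.d., so Hoeffding's bound on the moment
   generating function applies to them one coordinate at a time. The
   conditioning is expressed by the invariance of the product law under
   resampling one coordinate. A union bound over the class, and the Lipschitz
   assumption to pass from phi to psi, give the claim. *)

(** * Hoeffding's bound for a two-point law *)

Lemma derive_ge0_le (R : realType) (f f' : R -> R) :
  (forall x : R, is_derive x 1 f (f' x)) -> (forall x : R, 0 <= x -> 0 <= f' x) ->
  forall u : R, 0 <= u -> f 0 <= f u.
Proof.
move=> df f'ge0 u u_ge0; apply: (@ger0_derive1_ndecry _ f 0) => //.
- by move=> x; rewrite in_itv/= andbT => /ltW x0; rewrite derive1E derive_val f'ge0.
- by apply: derivable_within_continuous => x _; exact: ex_derive.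
Qed.

(** The gap [h] between the two sides vanishes at 0, and so does its derivative [k]. The derivative
    of [k] is 1/4 - q (1 - q) with q = [p * expR x / D x], hence nonnegative: a Bernoulli variance
    is at most 1/4. *)
Lemma hoeffding_ln (R : realType) (p u : R) : 0 <= p -> p <= 1 -> 0 <= u ->
  ln (1 - p + p * expR u) <= p * u + u ^+ 2 / 8.
Proof.
move=> p0 p1 u0.
have dq (x : R) : is_derive x 1 (8^-1 *: ((@id R) * id) + p *: id) (x / 4 + p).
  have dx := is_derive_id x 1.
  have := is_deriveD (is_deriveZ 8^-1 (is_deriveM dx dx)) (is_deriveZ p dx).
  move/is_derive_eq; apply.
  by rewrite -[LHS]/(8^-1 * (x * 1 + x * 1) + p * 1); field.
pose D (x : R) := 1 - p + p * expR x.
have D_gt0 x : 0 < D x.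
  rewrite /D; have [->|pn0] := eqVneq p 0; first by rewrite mul0r; lra.
  have : 0 < p * expR x by rewrite mulr_gt0 ?expR_gt0// lt_neqAle eq_sym pn0.
  lra.
have D_neq0 x : D x != 0 by rewrite gt_eqF.
have dD (x : R) : is_derive x 1 D (p * expR x).
  have -> : D = (fun=> 1 - p) + p *: (@expR R) by apply/funext.
  by rewrite -[_ * _]add0r; apply: is_deriveD.
pose k (x : R) := x / 4 + p - p * expR x / D x.
have dk (x : R) : is_derive x 1 k (4^-1 - (p * expR x * (1 - p)) / D x ^+ 2).
  have -> : k = (4^-1 *: id) + (fun=> p) - (p *: (@expR R)) * (fun x => (D x)^-1).
    by apply/funext => y; rewrite /k /= !fctE/= mulrC.
  have dV := is_deriveV (D_neq0 x) (dD x).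
  apply: is_derive_eq; 
  rewrite -[LHS]/(4^-1 * 1 + 0 - (p * expR x * (- D x ^- 2 * (p * expR x))
    + (D x)^-1 * (p * expR x))).
  have -> : 1 - p = D x - p * expR x by rewrite addrK.
  by field; exact: D_neq0.
have k_ge0 (x : R) : 0 <= x -> 0 <= k x.
  move=> x0; apply: le_trans _ (derive_ge0_le dk _ x0).
    rewrite /k /D expR0 mulr1 subrK divr1; lra.
  move=> y y0; rewrite subr_ge0 ler_pdivrMr ?exprn_gt0// /D.
  (* Since [D y] is (1 - p) + p exp y, this square gives 4 (1 - p) p exp y <= [D y ^+ 2]. *)
  have := sqr_ge0 (1 - p - p * expR y); set e := p * expR y => H0; nra.
pose h (x : R) := x ^+ 2 / 8 + p * x - ln (D x).
have dh (x : R) : is_derive x 1 h (k x).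
  have -> : h = 8^-1 *: ((@id R) * id) + p *: id - (@ln R \o D).
    by apply/funext => y; rewrite /h /= !fctE/= mulrC.
  have dL := is_derive1_comp (is_derive1_ln (D_gt0 x)) (dD x).
  by have := is_deriveB (dq x) dL; rewrite /k [p * _ / _]mulrC.
have := derive_ge0_le dh k_ge0 u0.
rewrite /h /D expR0 mulr1 subrK ln1; lra.
Qed.

(** The left side is the moment generating function at [t] of the centered law on {a, b}, with mass
    p = -a / (b - a) at b. Factoring out [expR (t * a)] reduces it to [hoeffding_ln] at u = t (b -
    a), whose linear term p u cancels t a. *)
Lemma hoeffding_expR (R : realType) (a b t : R) : a <= 0 -> 0 <= b -> a < b -> 0 <= t ->
  (b * expR (t * a) - a * expR (t * b)) / (b - a) <= expR (t ^+ 2 * (b - a) ^+ 2 / 8).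
Proof.
move=> a0 b0 ab t0.
have w0 : 0 < b - a by rewrite subr_gt0.
pose p := - a / (b - a).
have p0 : 0 <= p by rewrite divr_ge0 ?oppr_ge0// ltW.
have p1 : p <= 1 by rewrite ler_pdivrMr// mul1r; lra.
have u0 : 0 <= t * (b - a) by rewrite mulr_ge0// ltW.
have D0 : 0 < 1 - p + p * expR (t * (b - a)).
  have : p <= p * expR (t * (b - a)) by rewrite ler_peMr// -expR0 ler_expR.
  lra.
have := hoeffding_ln p0 p1 u0; rewrite -ler_expR lnK ?posrE// => H.
have -> : (b * expR (t * a) - a * expR (t * b)) / (b - a) =
    expR (t * a) * (1 - p + p * expR (t * (b - a))).
  have -> : expR (t * b) = expR (t * a) * expR (t * (b - a)).
    by rewrite -expRD; congr expR; ring.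
  by rewrite /p; field; rewrite gt_eqF.
apply: le_trans (ler_wpM2l (expR_ge0 _) H) _; rewrite -expRD ler_expR.
rewrite le_eqVlt; apply/orP; left; apply/eqP; rewrite /p; field; rewrite gt_eqF//.
Qed.

(** Convexity of exp, with weight (b - x) / (b - a) at a. The chord is written as an affine function
    of [x], so that integrating it over a centered variable leaves only the constant. *)
Lemma expR_le_chord (R : realType) (a b t x : R) : a < b -> a <= x -> x <= b ->
  expR (t * x) <= (b * expR (t * a) - a * expR (t * b)) / (b - a)
                  + (expR (t * b) - expR (t * a)) / (b - a) * x.
Proof.
move=> ab ax xb; have w0 : 0 < b - a by rewrite subr_gt0.
have w_neq0 : b - a != 0 by rewrite gt_eqF.
have s0 : 0 <= (b - x) / (b - a) by rewrite divr_ge0 ?subr_ge0// ltW.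
have s1 : (b - x) / (b - a) <= 1 by rewrite ler_pdivrMr// mul1r; lra.
have := convex_expR (Itv01 s0 s1) (t * a : R^o) (t * b : R^o).
rewrite !convRE/= /unstable.onem.
have -> : (b - x) / (b - a) * (t * a) + (1 - (b - x) / (b - a)) * (t * b) = t * x.
  by field.
by move=> /le_trans; apply; rewrite le_eqVlt; apply/orP; left; apply/eqP; field.
Qed.

(** * Hoeffding's lemma for bounded random variables *)

Section bounded_random_variable.
Context (R : realType) (dZ : measure_display) (Z : measurableType dZ).
Context (mu : probability Z R).

Lemma bounded_integrable (X : Z -> R) (a b : R) :
  measurable_fun setT X -> (forall z, a <= X z <= b) ->
  mu.-integrable setT (EFin \o X).
Proof.
move=> mX Xab; apply: measurable_bounded_integrable => //.
  by rewrite ?fin_num_fun_lty ?ltry//; apply: fin_num_measure.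
exists (`|a| + `|b|); split; first exact: num_real.
move=> M /ltW bM z _; apply: le_trans bM => /=.
have /andP[aX Xb] := Xab z; rewrite ler_norml; apply/andP; split.
  by rewrite opprD (le_trans _ aX)// lerBlDr (le_trans (lerNnormlW (lexx _)))// lerDl.
by rewrite (le_trans Xb)// (le_trans (ler_norm _))// lerDr.
Qed.

Lemma probability_Rintegral_cst (c : R) : \int[mu]_z c = c.
Proof.
rewrite Rintegral_cst// -[RHS]mulr1 -[X in _ = _ * X]/(fine 1%E).
by congr (_ * fine _); exact: probability_setT.
Qed.

Lemma Rintegral_between (X : Z -> R) (a b : R) :
  measurable_fun setT X -> (forall z, a <= X z <= b) ->
  a <= \int[mu]_z X z <= b.
Proof.
move=> mX Xab; have iX := bounded_integrable mX Xab.
have ic c : mu.-integrable setT (EFin \o (fun _ : Z => c)).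
  by apply: (@bounded_integrable _ c c) => // z; rewrite lexx.
apply/andP; split.
  rewrite -[leLHS]probability_Rintegral_cst.
  by apply: le_Rintegral => // z _; have /andP[] := Xab z.
rewrite -[leRHS]probability_Rintegral_cst.
by apply: le_Rintegral => // z _; have /andP[] := Xab z.
Qed.

Lemma hoeffding_mgf (X : Z -> R) (a b t : R) :
  measurable_fun setT X -> (forall z, a <= X z <= b) ->
  \int[mu]_z X z = 0 -> 0 <= t ->
  (\int[mu]_z (expR (t * X z))%:E <= (expR (t ^+ 2 * (b - a) ^+ 2 / 8))%:E)%E.
Proof.
move=> mX Xab EX0 t0.
have iX := bounded_integrable mX Xab.
have /andP[a0 b0] : a <= 0 <= b by rewrite -EX0 Rintegral_between.
have mE : measurable_fun setT (fun z => expR (t * X z)).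
  apply: measurableT_comp; first exact: measurable_expR.
  exact: measurable_funM.
pose chord0 := (b * expR (t * a) - a * expR (t * b)) / (b - a).
pose chord z := chord0
    + (expR (t * b) - expR (t * a)) / (b - a) * X z.
(* The chord divides by b - a; when b <= a, the bounds a <= 0 <= b force [X] to vanish
   identically. *)
have [ab|ba] := ltP a b; last first.
  have X0 z : X z = 0 by have := Xab z; lra.
  under eq_integral do rewrite X0 mulr0 expR0.
  rewrite integral_cst// [X in (_ * X)%E]probability_setT mule1 lee_fin -expR0 ler_expR.
  by rewrite divr_ge0// mulr_ge0 ?sqr_ge0.
have i2 : mu.-integrable setT
    (EFin \o (fun z => (expR (t * b) - expR (t * a)) / (b - a) * X z)).
  have := integrableZl _ ((expR (t * b) - expR (t * a)) / (b - a)) iX.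
  by apply.
have i1 : mu.-integrable setT
    (EFin \o (fun _ : Z => chord0)).
  by apply: (@bounded_integrable _ chord0 chord0) => // z; rewrite lexx.
have ichord : mu.-integrable setT (EFin \o chord).
  by have := integrableD _ i1 i2; apply.
have H : (\int[mu]_z (chord z)%:E = chord0%:E)%E.
  rewrite -[LHS]fineK; last exact: integrable_fin_num.
  rewrite -[fine _]/(\int[mu]_z chord z).
  have -> : \int[mu]_z chord z = \int[mu]_z chord0 +
      \int[mu]_z ((expR (t * b) - expR (t * a)) / (b - a) * X z).
    exact: RintegralD.
  have -> : \int[mu]_z ((expR (t * b) - expR (t * a)) / (b - a) * X z) =
      (expR (t * b) - expR (t * a)) / (b - a) * \int[mu]_z X z.
    exact: RintegralZl.
  by rewrite probability_Rintegral_cst EX0 mulr0 addr0.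
apply: (@le_trans _ _ (\int[mu]_z (chord z)%:E)%E).
  apply: ge0_le_integral => //.
  - exact/measurable_EFinP.
  - by case/integrableP: ichord.
  - by move=> z _; have /andP[az zb] := Xab z; rewrite lee_fin expR_le_chord.
by rewrite H lee_fin hoeffding_expR.
Qed.

End bounded_random_variable.

(** * Resampling one coordinate under the product law *)

Section resampling.
Context (R : realType) (n : nat) (dZ : measure_display) (Z : measurableType dZ).

Definition resample (i : 'I_n) (x : prodZ n Z) (z : Z) : prodZ n Z :=
  fun j => if j == i then z else x j.

Lemma measurable_rectangle (A : 'I_n -> set Z) :
  (forall i, measurable (A i)) ->
  measurable [set x : prodZ n Z | forall i, A i (x i)].
Proof. by move=> mA; apply: sub_sigma_algebra; exists A. Qed.

Lemma setI_closed_rectangles : setI_closed (@rectangles n dZ Z).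
Proof.
move=> _ _ [A [mA ->]] [B [mB ->]]; exists (fun i => A i `&` B i); split.
  by move=> i; exact: measurableI.
by apply/seteqP; split => x /= => [[? ?] i|H]; split => // i; case: (H i).
Qed.

Lemma measurable_coord (i : 'I_n) :
  measurable_fun [set: prodZ n Z] (fun x : prodZ n Z => x i).
Proof.
move=> _ Y mY; rewrite setTI.
rewrite (_ : _ @^-1` _ =
  [set x : prodZ n Z | forall j, (if j == i then Y else setT) (x j)]).
  by apply: (@measurable_rectangle (fun j => if j == i then Y else setT)) => j; case: ifP.
apply/seteqP; split => x /= => [Yx j|/(_ i)]; last by rewrite eqxx.
by case: eqP => // ->.
Qed.

Lemma measurable_fun_prodZ (d : measure_display) (W : measurableType d)
    (h : W -> prodZ n Z) :
  (forall i, measurable_fun setT (fun w => h w i)) -> measurable_fun setT h.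
Proof.
move=> mh; have := @measurability _ _ W (prodZ n Z) setT h (@rectangles n dZ Z) erefl; apply.
move=> _ [_ [A [mA ->]] <-]; rewrite setTI.
rewrite (_ : _ @^-1` _ = \big[setI/setT]_(i < n) ((fun w => h w i) @^-1` A i)).
  by apply: bigsetI_measurable => i _; rewrite -[X in measurable X]setTI; exact: mh.
rewrite -bigcap_seq; apply/seteqP; split => w /= H i => [_|]; first exact: H.
by apply: H; rewrite /= mem_index_enum.
Qed.

Lemma measurable_resample (i : 'I_n) :
  measurable_fun setT (fun w : prodZ n Z * Z => resample i w.1 w.2).
Proof.
apply: measurable_fun_prodZ => j; rewrite /resample; case: eqP => _.
  exact: measurable_snd.
exact: (measurableT_comp (measurable_coord j) measurable_fst).
Qed.

Context (mu : probability Z R) (P : probability (prodZ n Z) R).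
Hypothesis P_iid : is_iid_law mu P.

(** The two measures agree on rectangles, a pi-system containing the whole space: the preimage of a
    rectangle frees coordinate [i] of [x] and asks [z] to lie in [A i], so its mass is again the
    product of the [mu (A j)]. *)
Lemma pushforward_resample (i : 'I_n) (S : set (prodZ n Z)) : measurable S ->
  pushforward (P \x mu)%E (fun w : prodZ n Z * Z => resample i w.1 w.2) S = P S.
Proof.
move=> mS; have mr := measurable_resample i.
pose m1 : {measure set prodZ n Z -> \bar R} :=
  pushforward (P \x mu)%E (fun w : prodZ n Z * Z => resample i w.1 w.2).
rewrite -[LHS]/(m1 mr S).
apply: (@measure_unique _ R (prodZ n Z) (@rectangles n dZ Z) (fun=> setT)) => //.
- exact: setI_closed_rectangles.
- by move=> _; exists (fun=> setT); split => //; apply/seteqP; split.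
- by rewrite bigcup_const.
- move=> _ [A [mA ->]]; rewrite /m1 /= /pushforward.
  rewrite (_ : _ @^-1` _ =
      [set x : prodZ n Z | forall j, (if j == i then setT else A j) (x j)] `*` A i).
    rewrite product_measure1E//; last first.
      apply: (@measurable_rectangle (fun j => if j == i then setT else A j)) => j.
      by case: ifP.
    pose Ai j := if j == i then setT else A j.
    have mAi j : measurable (Ai j) by rewrite /Ai; case: ifP.
    transitivity ((\prod_(j < n) mu (Ai j)) * mu (A i))%E.
      by congr (_ * _)%E; exact: P_iid.
    rewrite [RHS]P_iid// /Ai.
    rewrite [in LHS](bigD1 i)//= eqxx probability_setT mul1e muleC.
    rewrite [RHS](bigD1 i)//=; congr (_ * _)%E.
    by apply: eq_bigr => j /negbTE ->.
  apply/seteqP; split => -[x z]; rewrite /resample /=.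
    move=> H; split; last by have := H i; rewrite eqxx.
    by move=> j; case: ifPn => // /negbTE ji; have := H j; rewrite ji.
  by move=> [H Az] j; have := H j; case: eqP => // ->.
- move=> _; rewrite /m1 /= /pushforward preimage_setT.
  by rewrite probability_setT ltry.
Qed.

(** This plays the role of conditioning: the inner integral is the expectation of [h] given all
    coordinates but the [i]-th. *)
Lemma integral_resample (i : 'I_n) (h : prodZ n Z -> \bar R) :
  measurable_fun setT h -> (forall x, 0 <= h x)%E ->
  (\int[P]_x h x = \int[P]_x \int[mu]_z h (resample i x z))%E.
Proof.
move=> mh h0; have mr := measurable_resample i.
transitivity (\int[pushforward (P \x mu)%E
    (fun w : prodZ n Z * Z => resample i w.1 w.2)]_x h x)%E.
  apply: eq_measure_integral => S mS _; symmetry; exact: pushforward_resample.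
rewrite ge0_integral_pushforward// preimage_setT.
rewrite fubini_tonelli1//.
  exact: (measurableT_comp mh mr).
by move=> w; exact: h0.
Qed.
(** [g x] is the function selected by the sample, unchanged when a coordinate in [s] is resampled.
    Resampling the head of [s] thus leaves the rest of the sum fixed, so the exponential factors and
    [hoeffding_mgf] bounds the inner integral; induction on [s] does the rest. *)
Lemma mgf_sum_le (g : prodZ n Z -> Z -> R) (B t : R) (s : seq 'I_n) :
  uniq s -> 0 <= t ->
  (forall i x z, i \in s -> g (resample i x z) = g x) ->
  (forall i, measurable_fun setT (fun x => g x (x i))) ->
  (forall x, measurable_fun setT (g x)) ->
  (forall x, exists a b, b - a <= B /\ forall z, a <= g x z <= b) ->
  (forall x, \int[mu]_z g x z = 0) ->
  (\int[P]_x (expR (t * \sum_(i <- s) g x (x i)))%:E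
     <= (expR ((size s)%:R * (t ^+ 2 * B ^+ 2 / 8)))%:E)%E.
Proof.
move=> + t0 + mgi mg bg g0.
have mS r : measurable_fun setT (fun x => (expR (t * \sum_(i <- r) g x (x i)))%:E).
  apply/measurable_EFinP; apply: measurableT_comp; first exact: measurable_expR.
  by apply: measurable_funM => //; exact: measurable_sum.
elim: s => [|i s IHs] /=.
  move=> _ _; under eq_integral do rewrite big_nil mulr0 expR0.
  by rewrite integral_cst// [X in (_ * X)%E]probability_setT mule1 mul0r expR0.
move=> /andP[i_s us] gE.
rewrite (integral_resample i) => [||x]; [|exact: mS|by rewrite lee_fin expR_ge0].
pose c := expR (t ^+ 2 * B ^+ 2 / 8).
have inner x : (\int[mu]_z (expR (t * \sum_(j <- i :: s)
      g (resample i x z) (resample i x z j)))%:E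
    <= c%:E * (expR (t * \sum_(j <- s) g x (x j)))%:E)%E.
  have split_head z : (expR (t * \sum_(j <- i :: s)
        g (resample i x z) (resample i x z j)))%:E =
      ((expR (t * \sum_(j <- s) g x (x j)))%:E * (expR (t * g x z))%:E)%E.
    rewrite big_cons gE ?mem_head// -EFinM -expRD -mulrDr addrC.
    rewrite [resample i x z i]/resample eqxx.
    have -> // : \sum_(j <- s) g x (resample i x z j) = \sum_(j <- s) g x (x j).
    rewrite big_seq [RHS]big_seq; apply: eq_bigr => j js.
    by rewrite /resample; case: eqP => // ji; rewrite -ji js in i_s.
  under eq_integral do rewrite split_head.
  have mE : measurable_fun setT (fun z => (expR (t * g x z))%:E).
    apply/measurable_EFinP; apply: measurableT_comp; first exact: measurable_expR.
    exact: measurable_funM.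
  rewrite ge0_integralZl_EFin ?expR_ge0//.
  rewrite muleC; apply: lee_wpmul2r; first by rewrite lee_fin expR_ge0.
  have [a [b [baB gab]]] := bg x.
  apply: (le_trans (hoeffding_mgf (mg x) gab (g0 x) t0)).
  rewrite lee_fin /c ler_expR ler_wpM2r// ler_wpM2l ?sqr_ge0//.
  (* Squaring b - a <= B needs 0 <= b - a, which the zero mean provides. *)
  have /andP[ag gb] : a <= 0 <= b by rewrite -(g0 x) Rintegral_between.
  by rewrite ler_pXn2r// nnegrE; lra.
apply: (@le_trans _ _ (\int[P]_x (c%:E * (expR (t * \sum_(j <- s) g x (x j)))%:E))%E).
  apply: ge0_le_integral => //.
  - by move=> x _; apply: integral_ge0.
  - have mh := measurableT_comp (mS (i :: s)) (measurable_resample i).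
    have := @measurable_fun_fubini_tonelli_F _ _ _ _ R mu _ mh.
    by apply => w /=; rewrite lee_fin expR_ge0.
  - by apply: emeasurable_funM.
rewrite ge0_integralZl_EFin ?expR_ge0//.
rewrite -natr1 mulrDl mul1r addrC expRD EFinM.
by apply: lee_wpmul2l; rewrite ?lee_fin ?expR_ge0//; apply: IHs => // j x z js;
  rewrite gE// in_cons js orbT.
Qed.

(** Chernoff's bound applied to [mgf_sum_le]. The length of [s] is relaxed to [n], which makes the
    bound the same for every set of unread samples. *)
Lemma sum_tail_le (g : prodZ n Z -> Z -> R) (B r : R) (s : seq 'I_n) :
  (0 < n)%N -> uniq s -> 0 < B -> 0 < r ->
  (forall i x z, i \in s -> g (resample i x z) = g x) ->
  (forall i, measurable_fun setT (fun x => g x (x i))) ->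
  (forall x, measurable_fun setT (g x)) ->
  (forall x, exists a b, b - a <= B /\ forall z, a <= g x z <= b) ->
  (forall x, \int[mu]_z g x z = 0) ->
  (P [set x | r <= \sum_(i <- s) g x (x i)]%R
     <= (expR (- (2 * r ^+ 2 / (n%:R * B ^+ 2))))%:E)%E.
Proof.
move=> n_gt0 us B0 r0 gE mgi mg bg g0.
have n0 : 0 < n%:R :> R by rewrite ltr0n.
have mS : measurable_fun setT (fun x : prodZ n Z => \sum_(i <- s) g x (x i)).
  exact: measurable_sum.
(* The minimizer of n t^2 B^2 / 8 - t r, with minimum -2 r^2 / (n B^2). *)
pose t := 4 * r / (n%:R * B ^+ 2).
have t0 : 0 < t by rewrite divr_gt0 ?mulr_gt0 ?exprn_gt0.
pose X : {RV P >-> R} := mfun_Sub (mem_set mS).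
apply: (le_trans (chernoff X r t0)).
rewrite /mmt_gen_fun unlock.
have -> : (\int[P]_x ((expR \o t \o* X) x)%:E =
    \int[P]_x (expR (t * \sum_(i <- s) g x (x i)))%:E)%E.
  by apply: eq_integral => x _; rewrite /= mulrC.
have := mgf_sum_le us (ltW t0) gE mgi mg bg g0.
move=> /(lee_wpmul2r (x := (expR (- (t * r)))%:E)).
rewrite lee_fin expR_ge0 => /(_ isT) /le_trans; apply.
rewrite -EFinM -expRD lee_fin ler_expR.
have sn : (size s)%:R <= n%:R :> R.
  by rewrite ler_nat -[leqRHS](card_ord n) -(card_uniqP us) max_card.
apply: (@le_trans _ _ (n%:R * (t ^+ 2 * B ^+ 2 / 8) - t * r)).
  by rewrite lerD2r ler_wpM2r// divr_ge0// mulr_ge0 ?sqr_ge0.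
rewrite le_eqVlt; apply/orP; left; apply/eqP; rewrite /t; field.
by rewrite !gt_eqF.
Qed.
End resampling.

(** * Separability and measurability at a random parameter *)

Section separability.
Context (R : realType) (d : nat).

(** This norm stands in for [enorm], which it dominates: its triangle inequality, measurability and
    approximation by rationals are all coordinatewise. *)
Definition l1norm (v : 'rV[R]_d) : R := \sum_(j < d) `|v ord0 j|.

Lemma l1norm_ge0 v : 0 <= l1norm v.
Proof. exact: sumr_ge0. Qed.

Lemma l1normB v w : l1norm (v - w) = l1norm (w - v).
Proof. by apply: eq_bigr => j _; rewrite !mxE distrC. Qed.

Lemma l1norm_triangle v w u : l1norm (v - u) <= l1norm (v - w) + l1norm (w - u).
Proof.
rewrite -big_split /=; apply: ler_sum => j _; rewrite !mxE.
by rewrite -[leLHS](_ : `|v ord0 j - w ord0 j + (w ord0 j - u ord0 j)| = _)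
  ?ler_normD// addrA subrK.
Qed.

Lemma enorm_le_l1norm v : enorm v <= l1norm v.
Proof.
rewrite /enorm -[leRHS]ger0_norm ?l1norm_ge0// -sqrtr_sqr ler_wsqrtr// /l1norm.
elim: (index_enum _) => [|j s IHs]; first by rewrite !big_nil expr0n.
rewrite !big_cons -[v ord0 j ^+ 2]real_normK ?num_real//.
have : 0 <= \sum_(i <- s) `|v ord0 i| by exact: sumr_ge0.
move: IHs (normr_ge0 (v ord0 j)).
move: (\sum_(_ <- _) _) (\sum_(_ <- _) _) (`|_|) => /= x y z; nra.
Qed.

Lemma rat_approx (v : 'rV[R]_d) (e : R) : 0 < e ->
  exists q : 'rV[rat]_d, l1norm (v - map_mx ratr q) < e.
Proof.
(* Dividing by [d.+1] covers d = 0 and makes the final inequality strict. *)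
move=> e0; pose e' := e / d.+1%:R.
have e'0 : 0 < e' by rewrite divr_gt0.
have /choice [q qP] (j : 'I_d) : exists q : rat, `|v ord0 j - ratr q| < e'.
  have [|q] := @rat_in_itvoo R (v ord0 j - e') (v ord0 j + e'); first by lra.
  by rewrite in_itv/= => qv; exists q; rewrite ltr_norml; lra.
exists (\row_j q j); apply: (@le_lt_trans _ _ (\sum_(j < d) e')).
  by apply: ler_sum => j _; rewrite !mxE ltW.
rewrite sumr_const card_ord -[_ *+ d]mulr_natr /e' mulrAC ltr_pdivrMr// ltr_pM2l//.
by rewrite ltr_nat.
Qed.

(** Rational points may lie outside [Theta], so for each rational point and each radius 1 / (k + 1)
    the sequence keeps a point of [Theta] within that radius if there is one, and the default [v0]
    otherwise. *)
Lemma dense_sequence (Theta : set 'rV[R]_d) : Theta !=set0 ->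
  exists theta : nat -> 'rV[R]_d, (forall k, Theta (theta k)) /\
    forall v e, Theta v -> 0 < e -> exists k, l1norm (v - theta k) < e.
Proof.
move=> [v0 v0T].
have /choice [c cP] (p : 'rV[rat]_d * nat) : exists v, Theta v /\ forall w, Theta w ->
    l1norm (w - map_mx ratr p.1) < p.2.+1%:R^-1 ->
    l1norm (v - map_mx ratr p.1) < p.2.+1%:R^-1.
  have [[v [vT vp]]|no] := pselect (exists v, Theta v /\
      l1norm (v - map_mx ratr p.1) < p.2.+1%:R^-1).
    by exists v; split.
  by exists v0; split => // w wT wp; case: no; exists w.
exists (fun k => c (odflt (0, 0%N) (unpickle k))); split => [k|v e vT e0].
  by case: (cP (odflt (0, 0%N) (unpickle k))).
(* Both [v] and the kept point will be within 1 / (k + 1) < e / 2 of the same rational point. *)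
have [k ke] : exists k : nat, k.+1%:R^-1 < e / 2.
  exists (Num.trunc (e / 2)^-1).
  rewrite invf_plt ?posrE ?ltr0n ?divr_gt0//.
  exact: truncnS_gt.
have [q qv] := @rat_approx v k.+1%:R^-1 ltac:(by rewrite invr_gt0).
exists (pickle (q, k)); rewrite pickleK /=.
have [_ /(_ v vT qv) /= qc] := cP (q, k).
apply: (le_lt_trans (l1norm_triangle _ (map_mx ratr q) _)).
rewrite [X in _ + X]l1normB [ltRHS]splitr.
by apply: ltrD; [exact: lt_trans ke|exact: lt_trans ke].
Qed.

(* McShane's extension formula turns the value of a Lipschitz function at a
   random point into a countable infimum of measurable functions. *)
Lemma measurable_fun_lipschitz (dZ dW : measure_display)
    (Z : measurableType dZ) (W : measurableType dW)
    (Theta : set 'rV[R]_d) (G : 'rV[R]_d -> Z -> R) (K : R)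
    (u : W -> 'rV[R]_d) (w : W -> Z) :
  0 <= K -> (forall v, Theta v -> measurable_fun setT (G v)) ->
  (forall v v' z, Theta v -> Theta v' -> G v z <= G v' z + K * l1norm (v - v')) ->
  (forall x, Theta (u x)) ->
  (forall j, measurable_fun setT (fun x => u x ord0 j)) ->
  measurable_fun setT w ->
  measurable_fun setT (fun x => G (u x) (w x)).
Proof.
move=> K0 mG lipG uT mu mw.
(* A point of [Theta] is obtained as a value of [u], so an empty [W] is treated apart. *)
have [x0|/forallNP noW] := pselect (exists x : W, True); last first.
  move=> _ Y _; rewrite (_ : _ `&` _ = set0)//.
  by apply/seteqP; split => // x; case: (noW x).
have [theta [thetaT theta_dense]] : exists theta : nat -> 'rV[R]_d,
    (forall k, Theta (theta k)) /\
    forall v e, Theta v -> 0 < e -> exists k, l1norm (v - theta k) < e.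
  by apply: dense_sequence; case: x0 => x _; exists (u x).
pose h k x := G (theta k) (w x) + K * l1norm (u x - theta k).
have hlb x k : G (u x) (w x) <= h k x by exact: lipG.
have mh k : measurable_fun setT (h k).
  apply: measurable_funD; first exact: (measurableT_comp (mG _ (thetaT k)) mw).
  apply: measurable_funM => //; rewrite /l1norm; apply: measurable_sum => j.
  apply: measurableT_comp; first exact: normr_measurable.
  under eq_fun do rewrite !mxE; exact: measurable_funB.
rewrite (_ : (fun x => _) = fun x => infs (h ^~ x) 0).
  apply: measurable_fun_infs => // x _; exists (G (u x) (w x)).
  by move=> _ [k _ <-].
apply/funext => x; apply/eqP; rewrite eq_le; apply/andP; split.
  apply: lb_le_inf; first by exists (h 0%N x), 0%N.
  by move=> _ [k _ <-].
apply/ler_addgt0Pr => e e0.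
(* [h k x] exceeds the target by at most 2 K times the distance; the added 1 covers K = 0. *)
have [k ke] := theta_dense (u x) (e / (2 * K + 1)) (uT x) ltac:(by rewrite divr_gt0//; lra).
apply: (@le_trans _ _ (h k x)).
  apply: ge_inf; last by exists k.
  by exists (G (u x) (w x)) => _ [l _ <-].
have := lipG (theta k) (u x) (w x) (thetaT k) (uT x); rewrite l1normB /h.
move: ke; rewrite ltr_pdivlMr; last lra.
have := l1norm_ge0 (u x - theta k).
move: (l1norm _) => l; nra.
Qed.

End separability.

(** * Bounds and measurability for the centered loss *)

Lemma ereal_oscillation_bounds (R : realType) (Z : Type) (X : Z -> R) (B : R) (z0 : Z) :
  (ereal_sup (range (fun z => (X z)%:E)) - ereal_inf (range (fun z => (X z)%:E))
    <= B%:E)%E ->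
  exists a b, b - a <= B /\ forall z, a <= X z <= b.
Proof.
set S := range _ => H.
have supX z : ((X z)%:E <= ereal_sup S)%E by apply: ereal_sup_ubound; exists z.
have infX z : (ereal_inf S <= (X z)%:E)%E by apply: ereal_inf_lbound; exists z.
have := supX z0; have := infX z0; move: supX infX H.
(* The value at [z0] excludes a supremum -oo and an infimum +oo; the real bound [B] excludes the
   other infinite cases. *)
case: (ereal_sup S) => [b| |]; case: (ereal_inf S) => [a| |]; rewrite /= ?leye_eq ?leeNy_eq //.
move=> supX infX ba _ _; exists a, b; split; first by rewrite -lee_fin EFinB.
by move=> z; rewrite -!lee_fin infX supX.
Qed.

Lemma probability_inhabited (R : realType) (dZ : measure_display)
  (Z : measurableType dZ) (mu : probability Z R) : exists z : Z, True.
Proof.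
apply: contrapT => /forallNP noZ.
have : mu setT = 1%E by exact: probability_setT.
rewrite (_ : setT = set0); last by apply/seteqP; split => // z; case: (noZ z).
by rewrite measure0 => /eqP; rewrite eq_sym onee_eq0.
Qed.

Section centered_loss.
Context (R : realType) (d : nat) (Theta : set 'rV[R]_d).
Context (dZ : measure_display) (Z : measurableType dZ) (mu : probability Z R).
Context (f : 'rV[R]_d -> Z -> R) (L B : R).
Hypothesis f_lip : exists h0 : 'rV[R]_d -> R, forall theta theta' z,
  theta \in Theta -> theta' \in Theta ->
  `| f theta z - h0 theta - (f theta' z - h0 theta') | <= L * enorm (theta - theta').
Hypothesis f_osc : forall theta, theta \in Theta ->
  (ereal_sup (range (fun z => (f theta z)%:E))
    - ereal_inf (range (fun z => (f theta z)%:E)) <= B%:E)%E.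
Hypothesis f_meas : forall theta, theta \in Theta -> measurable_fun setT (f theta).

Definition centered theta z := f theta z - popF mu f theta.

Lemma loss_bounds theta : theta \in Theta ->
  exists a b, b - a <= B /\ forall z, a <= f theta z <= b.
Proof.
have [z0 _] := probability_inhabited mu.
by move=> /f_osc; exact: ereal_oscillation_bounds.
Qed.

Lemma loss_integrable theta : theta \in Theta -> mu.-integrable setT (EFin \o f theta).
Proof.
move=> th; have [a [b [_ fab]]] := loss_bounds th.
by apply: bounded_integrable fab; exact: f_meas.
Qed.

Lemma measurable_centered theta : theta \in Theta -> measurable_fun setT (centered theta).
Proof. by move=> th; apply: measurable_funB => //; exact: f_meas. Qed.

Lemma centered_bounds theta : theta \in Theta ->
  exists a b, b - a <= B /\ forall z, a <= centered theta z <= b.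
Proof.
move=> /loss_bounds[a [b [ba fab]]]; exists (a - popF mu f theta), (b - popF mu f theta).
by split=> [|z]; [lra|rewrite !lerD2r].
Qed.

(** The value and the mean lie in the same interval of length at most B, so the constant is B and
    not 2 B. *)
Lemma norm_centered_le theta z : theta \in Theta -> `|centered theta z| <= B.
Proof.
move=> th; have [a [b [ba fab]]] := loss_bounds th.
have := Rintegral_between mu (f_meas th) fab; rewrite -[Rintegral _ _ _]/(popF mu f theta).
by have := fab z; rewrite /centered ler_norml; lra.
Qed.

Lemma Rintegral_centered theta : theta \in Theta -> \int[mu]_z centered theta z = 0.
Proof.
move=> th; have iF : mu.-integrable setT (EFin \o (fun _ : Z => popF mu f theta)).
  apply: (@bounded_integrable _ _ _ _ _ (popF mu f theta) (popF mu f theta)) => // z.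
  by rewrite lexx.
have -> : \int[mu]_z centered theta z = \int[mu]_z f theta z - \int[mu]_z popF mu f theta.
  by apply: RintegralB => //; exact: loss_integrable.
by rewrite probability_Rintegral_cst subrr.
Qed.

(* The reference function h0 cancels after centering, at the price of doubling
   the Lipschitz constant. *)
Lemma centered_lipschitz theta theta' z : theta \in Theta -> theta' \in Theta ->
  `|centered theta z - centered theta' z| <= 2 * L * enorm (theta - theta').
Proof.
move=> th th'; have [h0 f_h0] := f_lip.
pose e := L * enorm (theta - theta').
pose c := h0 theta - h0 theta'.
have fc y : c - e <= f theta y - f theta' y <= c + e.
  by have := f_h0 theta theta' y th th'; rewrite -/e ler_norml /c; lra.
have mff : measurable_fun setT (fun y => f theta y - f theta' y).
  by apply: measurable_funB; exact: f_meas.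
have := Rintegral_between mu mff fc.
have -> : \int[mu]_y (f theta y - f theta' y) = popF mu f theta - popF mu f theta'.
  by apply: RintegralB => //; exact: loss_integrable.
have := fc z; rewrite -[2 * L * _]mulrA -/e /centered ler_norml; lra.
Qed.

Lemma empF_sub_popF n (x : 'I_n -> Z) theta : (0 < n)%N ->
  empF f x theta - popF mu f theta = n%:R^-1 * \sum_(i < n) centered theta (x i).
Proof.
move=> n_gt0; rewrite /empF /centered sumrB mulrBr; congr (_ - _).
by rewrite sumr_const card_ord -[X in _ * X]mulr_natl mulKf// pnatr_eq0 -lt0n.
Qed.

(** The sample enters both through the parameter and as the argument of the loss, which is
    measurable only for a fixed parameter; the Lipschitz property makes the composite measurable. *)
Lemma measurable_centered_at n (i : 'I_n) (u : prodZ n Z -> 'rV[R]_d) :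
  0 <= L -> (forall x, u x \in Theta) ->
  (forall j, measurable_fun setT (fun x => u x ord0 j)) ->
  measurable_fun setT (fun x => centered (u x) (x i)).
Proof.
move=> L0 uT mu'.
apply: (@measurable_fun_lipschitz _ _ _ _ _ _ Theta centered (2 * L)) => //.
- by rewrite mulr_ge0.
- by move=> v /mem_set; exact: measurable_centered.
- move=> v v' z /mem_set vT /mem_set v'T.
  have := centered_lipschitz z vT v'T; rewrite ler_norml => /andP[_].
  rewrite lerBlDl => /le_trans; apply; rewrite lerD2l ler_wpM2l ?mulr_ge0//.
  exact: enorm_le_l1norm.
- by move=> x; apply: set_mem.
- exact: measurable_coord.
Qed.

End centered_loss.

(** * Deviation for one map, union bound and conclusion *)

Lemma measure_bigsetU_le (d : measure_display) (W : measurableType d) (R : realType)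
    (P : {measure set W -> \bar R}) (I : Type) (s : seq I) (A : I -> set W) (c : R) :
  (forall i, measurable (A i)) -> (forall i, P (A i) <= c%:E)%E ->
  (P (\big[setU/set0]_(i <- s) A i) <= ((size s)%:R * c)%:E)%E.
Proof.
move=> mA Ac; elim: s => [|i s IHs]; first by rewrite big_nil measure0 mul0r.
rewrite big_cons /= -natr1 mulrDl mul1r addrC EFinD.
have mB : measurable (\big[setU/set0]_(j <- s) A j) by exact: bigsetU_measurable.
apply: (le_trans (measureU2 _ (mA i) mB)).
apply: leeD; [exact: Ac|exact: IHs].
Qed.

(** [S] is the event that the sum over the unread samples reaches [r] in one of the two directions,
    whence the factor 2. The samples read contribute at most B each, whatever their values. *)
Lemma deviation_few_samples (R : realType) (d : nat) (Theta : set 'rV[R]_d)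
    (dZ : measure_display) (Z : measurableType dZ) (mu : probability Z R)
    (f : 'rV[R]_d -> Z -> R) (L B : R) (n T : nat) (P : probability (prodZ n Z) R)
    (phi : ('I_n -> Z) -> 'rV[R]_d) (r : R) :
  0 <= L -> 0 < B -> (0 < n)%N -> 0 < r ->
  (exists h0 : 'rV[R]_d -> R, forall theta theta' z,
    theta \in Theta -> theta' \in Theta ->
    `| f theta z - h0 theta - (f theta' z - h0 theta') | <= L * enorm (theta - theta')) ->
  (forall theta, theta \in Theta ->
    (ereal_sup (range (fun z => (f theta z)%:E))
      - ereal_inf (range (fun z => (f theta z)%:E)) <= B%:E)%E) ->
  (forall theta, theta \in Theta -> measurable_fun setT (f theta)) ->
  is_iid_law mu P -> (forall x, phi x \in Theta) -> depends_on_at_most T phi ->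
  (forall j, measurable_fun [set: prodZ n Z] (fun x : prodZ n Z => phi x ord0 j)) ->
  exists S : set (prodZ n Z), [/\ measurable S,
    (P S <= (2 * expR (- (2 * r ^+ 2 / (n%:R * B ^+ 2))))%:E)%E &
    forall x, ~ S x -> `|\sum_(i < n) centered mu f (phi x) (x i)| <= B * T%:R + r].
Proof.
move=> L0 B0 n_gt0 r0 f_lip f_osc f_meas P_iid phiT [I [IT phiI]] phi_meas.
pose s := enum (~: I).
pose g (x : prodZ n Z) z := centered mu f (phi x) z.
have gE i x z : i \in s -> phi (resample i x z) = phi x.
  rewrite mem_enum inE => iI; apply: phiI => j jI; rewrite /resample.
  by case: eqP => // ji; rewrite -ji jI in iI.
have mgi i : measurable_fun setT (fun x => g x (x i)).
  exact: (@measurable_centered_at _ _ Theta _ _ _ _ L B).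
have mS : measurable_fun setT (fun x : prodZ n Z => \sum_(i <- s) g x (x i)).
  exact: measurable_sum.
pose up := [set x : prodZ n Z | r <= \sum_(i <- s) g x (x i)].
(* Summing [- g] lets the one-sided tail bound apply again, to the opposite function. *)
pose down := [set x : prodZ n Z | r <= \sum_(i <- s) - g x (x i)].
have mup : measurable up.
  by rewrite -[up]setTI; apply: measurable_fun_le.
have mdown : measurable down.
  rewrite -[down]setTI; apply: measurable_fun_le => //.
  by apply: measurable_sum => i; exact: measurableT_comp.
exists (up `|` down); split; first exact: measurableU.
  apply: (le_trans (measureU2 _ mup mdown)).
  rewrite [2 * expR _]mulr_natl mulr2n EFinD; apply: leeD.
    apply: (sum_tail_le P_iid n_gt0 (enum_uniq _) B0 r0) => //.
    + by move=> i x z iS; apply/funext => y; rewrite /g gE.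
    + by move=> x; apply: (@measurable_centered _ _ Theta).
    + by move=> x; apply: (@centered_bounds _ _ Theta).
    + by move=> x; apply: (@Rintegral_centered _ _ Theta _ _ _ _ B).
  apply: (sum_tail_le (g := fun x z => - g x z) P_iid n_gt0 (enum_uniq _) B0 r0) => //.
  + by move=> i x z iS; apply/funext => y; rewrite /g gE.
  + by move=> i; apply: measurableT_comp.
  + move=> x; apply: measurableT_comp => //.
    exact: (@measurable_centered _ _ Theta).
  + move=> x; have [a [b [ba gab]]] := @centered_bounds _ _ Theta _ _ mu f B f_osc _ (phiT x).
    exists (- b), (- a); split; first lra.
    by move=> z; have := gab z; rewrite /g; lra.
  + move=> x; rewrite (_ : Rintegral _ _ _ = \int[mu]_z (- 1 * g x z)).
      have [a [b [_ gab]]] := @centered_bounds _ _ Theta _ _ mu f B f_osc _ (phiT x).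
      have mg := @measurable_centered _ _ Theta _ _ mu f f_meas _ (phiT x).
      have -> : \int[mu]_z (- 1 * g x z) = - 1 * \int[mu]_z g x z.
        by apply: RintegralZl => //; exact: bounded_integrable gab.
      by rewrite (@Rintegral_centered _ _ Theta _ _ mu f B) ?mulr0.
    by apply: eq_Rintegral => z _; rewrite mulN1r.
move=> x /not_orP[/negP xup /negP xdown].
have small : `|\sum_(i <- s) g x (x i)| <= r.
  move: xdown; rewrite sumrN ler_norml -ltNge; move: xup; rewrite -ltNge; lra.
have few : `|\sum_(i in I) g x (x i)| <= B * T%:R.
  apply: (le_trans (ler_norm_sum _ _ _)).
  apply: (@le_trans _ _ (\sum_(i in I) B)).
    by apply: ler_sum => i _; exact: (@norm_centered_le _ _ Theta).
  by rewrite sumr_const -[_ *+ _]mulr_natr ler_wpM2l ?ler_nat// ltW.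
rewrite (bigID (mem I)) /=; apply: (le_trans (ler_normD _ _)); apply: lerD => //.
apply: le_trans small; rewrite /s big_enum /= le_eqVlt; apply/orP; left; apply/eqP.
by congr `|_|; apply: eq_bigl => i; rewrite inE.
Qed.

Theorem theorem7
  (R : realType) (d : nat) (Theta : set 'rV[R]_d)
  (dZ : measure_display) (Z : measurableType dZ)
  (f : 'rV[R]_d -> Z -> R) (L B : R)
  (L_gt0 : 0 < L) (B_gt0 : 0 < B)
  (* Assumption 1 *)
  (assum1 : exists h0 : 'rV[R]_d -> R, forall theta theta' z,
     theta \in Theta -> theta' \in Theta ->
     `| f theta z - h0 theta - (f theta' z - h0 theta') |
       <= L * enorm (theta - theta'))
  (* Assumption 2 *)
  (assum2 : forall theta, theta \in Theta ->
     (ereal_sup (range (fun z => (f theta z)%:E))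
      - ereal_inf (range (fun z => (f theta z)%:E)) <= B%:E)%E)
  (* f(theta; .) is measurable, so that F(theta) = E_mu[f(theta;Z)] is defined *)
  (f_meas : forall theta, theta \in Theta -> measurable_fun setT (f theta))
  (mu : probability Z R)
  (n : nat) (n_gt0 : (0 < n)%N)
  (P : probability (prodZ n Z) R) (P_iid : is_iid_law mu P)
  (eps : R) (eps_gt0 : 0 < eps)
  (T : nat) (T_le_n : (T <= n)%N)
  (Phin : set (('I_n -> Z) -> 'rV[R]_d))
  (Phin_Theta : forall psi x, Phin psi -> psi x \in Theta)
  (m : nat) (phi : 'I_m -> (('I_n -> Z) -> 'rV[R]_d))
  (phi_inj : injective phi)
  (phi_Theta : forall k x, phi k x \in Theta)
  (phi_dep : forall k, depends_on_at_most T (phi k))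
  (phi_meas : forall k (j : 'I_d),
     measurable_fun [set: prodZ n Z] (fun x : prodZ n Z => phi k x ord0 j))
  (cover : forall (x : 'I_n -> Z) psi, Phin psi ->
     exists k, enorm (psi x - phi k x) <= eps)
  (delta : R) (delta_gt0 : 0 < delta) :
  exists E : set (prodZ n Z),
    measurable E /\ ((1 - delta)%:E <= P E)%E /\
    forall x : prodZ n Z, E x -> forall psi, Phin psi ->
      `| empF f x (psi x) - popF mu f (psi x) |
        <= B * T%:R / n%:R
           + B * Num.sqrt (ln (2 * m%:R / delta) / (2 * n%:R))
           + 2 * L * eps.
Proof.
have L0 := ltW L_gt0.
have nR : 0 < n%:R :> R by rewrite ltr0n.
(* For delta >= 1 the empty event is enough; delta < 1 later makes the logarithm positive. *)
have [delta_ge1|delta_lt1] := leP 1 delta.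
  exists set0; split; first exact: measurable0.
  by split=> //; rewrite measure0 lee_fin; lra.
(* If [Phin] is empty the full event works; otherwise covering one value of [psi0] shows m > 0. *)
have [[psi0 psi0P]|/forallNP noPsi] := pselect (exists psi, Phin psi); last first.
  exists setT; split; first exact: measurableT.
  split; last by move=> x _ psi /noPsi.
  by rewrite [leRHS]probability_setT lee_fin; lra.
have m_gt0 : 0 < m%:R :> R.
  have [z0 _] := probability_inhabited mu.
  have [k _] := cover (fun=> z0) psi0 psi0P.
  by rewrite ltr0n (leq_ltn_trans _ (ltn_ord k)).
pose l : R := ln (2 * m%:R / delta).
have m_ge1 : 1 <= m%:R :> R by move: m_gt0; rewrite ltr0n ler1n.
have arg_gt1 : 1 < 2 * m%:R / delta.
  by rewrite ltr_pdivlMr// mul1r; lra.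
have l_gt0 : 0 < l by exact: ln_gt0.
pose t := B * Num.sqrt (l / (2 * n%:R)).
have t_gt0 : 0 < t by rewrite mulr_gt0// sqrtr_gt0 divr_gt0// mulr_gt0.
have r_gt0 : 0 < n%:R * t by rewrite mulr_gt0.
(* The deviation n t of the sum is chosen so that the two-sided tail of one map is exactly delta /
   m. *)
have tail : 2 * expR (- (2 * (n%:R * t) ^+ 2 / (n%:R * B ^+ 2))) = delta / m%:R.
  have -> : 2 * (n%:R * t) ^+ 2 / (n%:R * B ^+ 2) = l.
    rewrite /t !exprMn sqr_sqrtr ?divr_ge0 ?mulr_ge0 ?ltW//.
    by field; rewrite !gt_eqF.
  rewrite expRN /l lnK ?posrE; last lra.
  by field; rewrite !gt_eqF.
have /choice [S SP] k := deviation_few_samples L0 B_gt0 n_gt0 r_gt0 assum1 assum2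
  f_meas P_iid (phi_Theta k) (phi_dep k) (phi_meas k).
have mS k : measurable (S k) by case: (SP k).
pose bad := \big[setU/set0]_(k <- enum 'I_m) S k.
have mbad : measurable bad by exact: bigsetU_measurable.
(* As [Phin] is arbitrary, the event is defined from the finite class alone, which makes it
   measurable. *)
exists (~` bad); split; first exact: measurableC.
split.
  have Pbad : (P bad <= delta%:E)%E.
    have := @measure_bigsetU_le _ _ _ P _ (enum 'I_m) S (delta / m%:R) mS.
    rewrite -cardE card_ord mulrCA divff ?gt_eqF// mulr1; apply=> k.
    by rewrite -tail; case: (SP k).
  by rewrite [leRHS]probability_setC// EFinB leeB.
move=> x xbad psi psiP.
(* The index [k] depends on [x], which is why [bad] gathers the exceptional sets of all maps of the
   class. *)
have [k psi_phi] := cover x psi psiP.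
have xS : ~ S k x.
  by move=> Sx; apply: xbad; rewrite /bad -bigcup_seq; exists k => //=; rewrite mem_enum.
have [_ _ /(_ x xS) dev] := SP k.
rewrite empF_sub_popF//.
have lip i : `|centered mu f (psi x) (x i) - centered mu f (phi k x) (x i)|
    <= 2 * L * eps.
  apply: (le_trans (centered_lipschitz mu assum1 assum2 f_meas (x i)
    (Phin_Theta _ x psiP) (phi_Theta k x))).
  by rewrite ler_wpM2l// mulr_ge0.
have -> : \sum_(i < n) centered mu f (psi x) (x i) =
    \sum_(i < n) centered mu f (phi k x) (x i) +
    \sum_(i < n) (centered mu f (psi x) (x i) - centered mu f (phi k x) (x i)).
  by rewrite -big_split; apply: eq_bigr => i _; rewrite [RHS]addrC subrK.
rewrite normrM gtr0_norm ?invr_gt0// [leLHS]mulrC ler_pdivrMr//.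
apply: (le_trans (ler_normD _ _)).
apply: (@le_trans _ _ (B * T%:R + n%:R * t + n%:R * (2 * L * eps))).
  apply: lerD => //; apply: (le_trans (ler_norm_sum _ _ _)).
  apply: (@le_trans _ _ (\sum_(i < n) 2 * L * eps)); first exact: ler_sum.
  by rewrite sumr_const card_ord -[X in X <= _]mulr_natl.
rewrite -/l -/t le_eqVlt; apply/orP; left; apply/eqP; field.
by rewrite gt_eqF.
Qed.
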